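(* Let $n$ be odd, let $\mathbb V_n$ be an $n$-dimensional vector space over $\mathbb F_2$, and let $f:\mathbb V_n\to\mathbb Z_{2^k}$ be a gbent function, written (uniquely) as $$f(\mathbf x)=a_1(\mathbf x)+2a_2(\mathbf x)+\cdots+2^{k-1}a_k(\mathbf x)$$ with Boolean functions $a_i:\mathbb V_n\to\mathbb F_2$, $1\le i\le k$. Then for each $\mathbf c=(c_1,\ldots,c_{k-1})\in\mathbb F_2^{k-1}$, the Boolean function $$g_{\mathbf c}(\mathbf x)=c_1a_1(\mathbf x)\oplus c_2a_2(\mathbf x)\oplus\cdots\oplus c_{k-1}a_{k-1}(\mathbf x)\oplus a_k(\mathbf x)$$ is semibent.
   Context: Values of Boolean functions are read as the integers $0,1$ when multiplied by powers of $2$ and added in $\mathbb Z_{2^k}$; $\oplus$ is addition in $\mathbb F_2$. Fix a nondegenerate inner product $\langle\cdot,\cdot\rangle$ on $\mathbb V_n$ (e.g. the dot product if $\mathbb V_n=\mathbb F_2^n$), and let $\zeta_{2^k}=e^{2\pi i/2^k}$. A function $f:\mathbb V_n\to\mathbb Z_{2^k}$ is called gbent (generalized bent) if $|\mathcal H_f^{(2^k)}(\mathbf u)|=2^{n/2}$ for all $\mathbf u\in\mathbb V_n$, where $$\mathcal H_f^{(2^k)}(\mathbf u)=\sum_{\mathbf x\in\mathbb V_n}\zeta_{2^k}^{f(\mathbf x)}(-1)^{\langle\mathbf u,\mathbf x\rangle}.$$ For $n$ odd, a Boolean function $g:\mathbb V_n\to\mathbb F_2$ is called semibent if $|\mathcal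 W_g(\mathbf u)|\in\{0,2^{(n+1)/2}\}$ for all $\mathbf u\in\mathbb V_n$, where $\mathcal W_g(\mathbf u)=\sum_{\mathbf x\in\mathbb V_n}(-1)^{g(\mathbf x)}(-1)^{\langle\mathbf u,\mathbf x\rangle}$. *)

(* Defs.v *)
From HB Require Import structures.
From mathcomp Require Import all_boot all_order all_algebra all_field.
From mathcomp Require Import complex.
From mathcomp Require Import reals trigo exp.
Set Implicit Arguments.
Unset Strict Implicit.
Unset Printing Implicit Defensive.
Import Order.TTheory GRing.Theory Num.Theory.
Local Open Scope ring_scope.
Local Open Scope complex_scope.

(* e^(2 pi i / 2^k) *)
Definition zeta (R : realType) (k : nat) : R[i] :=
  cos (2 * pi / 2 ^+ k) +i* sin (2 * pi / 2 ^+ k).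

(* A vectType over 'F_2 has no canonical finType structure; the alias
   finvect_type V of V has one.  An element of 'Z_(2 ^ k) or 'F_2 used as an
   exponent is coerced to its representative in {0, ..., 2 ^ k - 1} or {0, 1}.
   As 'Z_(2 ^ 0) is 'Z_2, this is the intended transform only for 0 < k. *)
Definition gen_walsh (R : realType) (k : nat) (V : vectType 'F_2)
    (ip : {symmetric V}) (f : V -> 'Z_(2 ^ k)) (u : V) : R[i] :=
  \sum_(x : finvect_type V) zeta R k ^+ f x * (-1) ^+ ip u x.

Definition gbent (R : realType) (k : nat) (V : vectType 'F_2)
    (ip : {symmetric V}) (f : V -> 'Z_(2 ^ k)) : Prop :=
  forall u : V,
    `|gen_walsh R ip f u| = ((2 : R) `^ ((\dim {:V})%:R / 2))%:C.

Definition walsh (V : vectType 'F_2) (ip : {symmetric V}) (g : V -> 'F_2)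
    (u : V) : int :=
  \sum_(x : finvect_type V) (-1) ^+ g x * (-1) ^+ ip u x.

(* Meant for \dim {:V} odd, so that the halving is exact. *)
Definition semibent (V : vectType 'F_2) (ip : {symmetric V})
    (g : V -> 'F_2) : Prop :=
  forall u : V,
    `|walsh ip g u| = 0 \/ `|walsh ip g u| = 2 ^+ ((\dim {:V}).+1)./2.

(* With k = m.+1, the index i : 'I_m.+1 of a stands for the index i + 1 of
   a_1, ..., a_k, so that a ord_max is a_k; similarly for c_1, ..., c_(k-1). *)
Definition binary_value (m : nat) (V : vectType 'F_2)
    (a : 'I_m.+1 -> V -> 'F_2) (x : V) : 'Z_(2 ^ m.+1) :=
  \sum_(i < m.+1) 2 ^+ i * (a i x : nat)%:R.

Definition component (m : nat) (V : vectType 'F_2)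
    (a : 'I_m.+1 -> V -> 'F_2) (c : 'rV['F_2]_m) (x : V) : 'F_2 :=
  \sum_(i < m) c 0 i * a (widen_ord (leqnSn m) i) x + a ord_max x.

(* Main.v *)
Require Import Defs.
From HB Require Import structures.
From mathcomp Require Import all_boot all_order all_algebra all_field.
From mathcomp Require Import complex ring zify.
From mathcomp Require Import reals trigo exp.
Set Implicit Arguments.
Unset Strict Implicit.
Unset Printing Implicit Defensive.
Import Order.TTheory GRing.Theory Num.Theory.
Local Open Scope ring_scope.

(** Let z = zeta_(2^k), N = 2^(k-1) and i = z^(N/2), so that i^2 = -1. Sorting
    the x by the value v(x) < N of their k - 1 low digits, H_f(u) = P(z) where
    P = sum_x (-1)^(a_k(x) + <u,x>) X^v(x) is an integer polynomial of degree
    < N, and W_(g_c)(u) is the image of P under the linear form sending X^j to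
    the sign (-1)^(c . digits of j). Since X^N + 1 is irreducible, P is
    determined by P(z), and |P(z)|^2 = 2^n leaves little room. Modulo 2 one has
    X^N + 1 = (X + 1)^N, and P(X) and P(1/X) vanish to the same order at 1, so
    P is divisible by (X + 1)^(N/2) = X^(N/2) + 1 modulo 2; as
    (1 + i)(1 - i) = 2, P(z) is divisible by 1 + i. Iterating,
    P(z) = (1 + i)^n U(z) with |U(z)| = 1; the constant coefficient of this
    norm equation says that the squares of the coefficients of U sum to 1, so
    U(z) is plus or minus a power of z. As (1 + i)^2 = 2i and n = 2h + 1, P is
    2^h times a sum of two signed monomials, and W_(g_c)(u) is 2^h (+-1 +-1).
    For k = 1, P is an integer of square 2^n, which is impossible. *)

(** * Irreducibility of X^N + 1 for N a power of 2, and independence of the powers of its root *)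

Lemma natr2_poly_F2 : 2%:R = 0 :> {poly 'F_2}.
Proof. by rewrite -polyC_natr pchar_Fp_0. Qed.

Lemma pnat2_poly_F2 m : [pchar {poly 'F_2}].-nat (2 ^ m)%N.
Proof. by rewrite pnatX pnatE // (pchar_poly 'F_2) pchar_Fp. Qed.

(* X^(2^m) + 1 shifted so that Eisenstein's criterion applies at 2. *)
Lemma irreducible_XaddC1Xn_addC1 m :
  irreducible_poly (('X + 1) ^+ (2 ^ m) + 1 : {poly int}).
Proof.
set N := (2 ^ m)%N; have N_gt0 : (0 < N)%N by rewrite expn_gt0.
pose q : {poly int} := 'X^N + 1.
have szq : size q = N.+1 by rewrite size_XnaddC.
have szX : size ('X + 1 : {poly int}) = 2%N by rewrite size_XaddC.
set Q := _ + 1; have QE : Q = q \Po ('X + 1).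
  rewrite /Q /q comp_polyD comp_Xn_poly.
  by rewrite -[1 in X in _ = _ + X]polyC1 comp_polyC.
have szQ : size Q = N.+1 by rewrite QE size_comp_poly2.
have lQ : lead_coef Q = 1.
  rewrite QE lead_coef_comp ?szX // lead_coefXaddC expr1n mulr1.
  by rewrite /q lead_coefXnaddC.
apply: (@eisenstein_crit 2) => //; rewrite ?lQ ?szQ //.
- by rewrite eqSS -lt0n.
- by rewrite -horner_coef0 /Q !hornerE /= expr1n.
move=> i /= lt_iN.
rewrite (dvdz_pcharf (pchar_Fp (isT : prime 2))) -coef_map /=.
rewrite /Q rmorphD rmorphXn rmorphD /= map_polyX rmorph1.
(* Modulo 2 the power is X^N + 1, and the two constants cancel, leaving X^N alone. *)
rewrite exprDn_pchar ?pnat2_poly_F2 // expr1n -addrA.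
rewrite -[1 + 1]/(2%:R) natr2_poly_F2 addr0.
by rewrite coefXn (ltn_eqF lt_iN).
Qed.

Section PowerTwoRootOfUnity.

Variables (F : numFieldType) (m : nat) (z : F).
Hypothesis zN : z ^+ (2 ^ m) = -1.

Local Notation "p %:ev" := (map_poly intr p).[z] (at level 2).

(** After the shift by 1, [z - 1] is a root of an irreducible rational polynomial of degree 2^m; a
    nonzero polynomial of smaller degree is coprime to it and cannot share this root. *)
Lemma root_unity_lin_indep (p : {poly int}) :
  (size p <= 2 ^ m)%N -> p%:ev = 0 -> p = 0.
Proof.
move=> szp pz0; apply/eqP/negPn/negP => p_neq0.
have szX : size ('X + 1 : {poly rat}) = 2%N by rewrite size_XaddC.
pose p' : {poly rat} := map_poly intr p \Po ('X + 1).
pose q : {poly rat} := map_poly intr (('X + 1) ^+ (2 ^ m) + 1 : {poly int}).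
have szp' : size p' = size p by rewrite size_comp_poly2 // size_rat_int_poly.
have qE : q = ('X + 1) ^+ (2 ^ m) + 1.
  by rewrite /q rmorphD rmorphXn rmorphD /= map_polyX !rmorph1.
have szq : size q = (2 ^ m).+1.
  have -> : q = ('X^(2 ^ m) + 1) \Po ('X + 1).
    rewrite qE comp_polyD comp_Xn_poly.
    by rewrite -[1 in X in _ = _ + X]polyC1 comp_polyC.
  by rewrite size_comp_poly2 // size_XnaddC // expn_gt0.
have irr_q : irreducible_poly q.
  by apply/irreducible_rat_int/irreducible_XaddC1Xn_addC1.
have cop : coprimep (map_poly (ratr : rat -> F) q) (map_poly ratr p').
  rewrite coprimep_map irreducible_poly_coprime //.
  apply/negP => /dvdp_leq; rewrite szq szp' ltnNge szp.
  by rewrite -size_poly_eq0 szp' size_poly_eq0 => /(_ p_neq0).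
have /(coprimep_root cop)/eqP[] : root (map_poly (ratr : rat -> F) q) (z - 1).
  rewrite qE rmorphD rmorphXn rmorphD /= map_polyX !rmorph1.
  by rewrite rootE !hornerE subrK zN addNr.
rewrite /p' map_comp_poly rmorphD /= map_polyX rmorph1 horner_comp !hornerE subrK.
rewrite -map_poly_comp -[RHS]pz0; congr _.[_]; apply: eq_map_poly => x /=.
by rewrite ratr_int.
Qed.

Lemma ev_reduce (p : {poly int}) : exists q r : {poly int},
  [/\ p = q * ('X^(2 ^ m) + 1) + r, (size r <= 2 ^ m)%N & r%:ev = p%:ev].
Proof.
have mon : ('X^(2 ^ m) + 1 : {poly int}) \is monic.
  by rewrite monicXnaddC ?expn_gt0.
have := Pdiv.RingMonic.rdivp_eq mon p.
set q := Pdiv.Ring.rdivp _ _; set r := Pdiv.Ring.rmodp _ _ => pE.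
exists q, r; split => //.
  rewrite -ltnS -(@size_XnaddC int (2 ^ m) 1) ?expn_gt0 //.
  by rewrite Pdiv.Ring.ltn_rmodp monic_neq0.
rewrite pE rmorphD rmorphM rmorphD /= map_polyXn rmorph1.
by rewrite !hornerE zN addNr mulr0 add0r.
Qed.

Lemma ev_eq0_dvd (p : {poly int}) :
  p%:ev = 0 -> exists q, p = q * ('X^(2 ^ m) + 1).
Proof.
have [q [r [pE szr rE]]] := ev_reduce p => pz0; exists q.
by rewrite [LHS]pE (root_unity_lin_indep szr) ?addr0 // rE.
Qed.

End PowerTwoRootOfUnity.

(** * Multiplicity of the root 1, and reduction modulo 2 *)

Lemma mup_comp_polyXn (K : fieldType) (k : nat) (p : {poly K}) :
  k%:R != 0 :> K -> p != 0 -> mup 1 (p \Po 'X^k) = mup 1 p.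
Proof.
move=> k_neq0 p_neq0.
have [v [q]] := multiplicity_XsubC p 1; rewrite p_neq0 /= => q1 ->.
rewrite comp_polyM mupMr; last by rewrite root_comp hornerXn expr1n.
(* X^k - 1 is X - 1 times 1 + X + ... + X^(k-1), whose value k at 1 is nonzero, so the substitution
   adds no multiplicity. *)
rewrite [RHS]mupMr // rmorphXn rmorphB /= comp_polyX comp_polyC polyC1 subrX1.
rewrite exprMn mupMl // rootE horner_exp horner_sum.
rewrite expf_neq0 // (eq_bigr (fun=> 1)) => [|i _].
  by rewrite sumr_const card_ord.
by rewrite hornerXn expr1n.
Qed.

(** Both factors have the same multiplicity at 1, so each carries exactly half of that of the
    product. *)
Lemma dvdp_XsubC1_comp_poly (K : fieldType) (k M : nat) (p : {poly K}) :
    k%:R != 0 :> K ->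
  ('X - 1) ^+ (M.*2) %| p * (p \Po 'X^k) -> ('X - 1) ^+ M %| p.
Proof.
move=> k_neq0; have [-> | p_neq0] := eqVneq p 0; first by rewrite dvdp0.
have k_gt0 : (0 < k)%N by case: k k_neq0 => //; rewrite eqxx.
have pk_neq0 : p \Po 'X^k != 0 by rewrite comp_poly_eq0 // size_polyXn.
rewrite -polyC1 -!mup_geq ?mulf_neq0 // mupM // mup_comp_polyXn //.
by rewrite addnn leq_double.
Qed.

Lemma poly_mod2_eq0 (p : {poly int}) :
  map_poly intr p = 0 :> {poly 'F_2} -> exists t, p = t *+ 2.
Proof.
move=> p0; exists (map_poly (fun c => (c %/ 2)%Z) p); apply/polyP => i.
rewrite coefMn coef_map_id0 //.
have /eqP := congr1 (fun q : {poly 'F_2} => q`_i) p0.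
rewrite coef0 coef_map /= -(dvdz_pcharf (pchar_Fp (isT : prime 2))).
move=> /divzK {1}<-.
by rewrite -[RHS]mulr_natr natz.
Qed.

(** * Integer combinations of powers of z whose squared modulus is a power of 2 *)

Section IntegerCombinations.

Variables (F : numClosedFieldType) (m : nat) (z : F).
Hypothesis zN : z ^+ (2 ^ m.+1) = -1.
Hypothesis z_norm1 : z * z^* = 1.

Local Notation "p %:ev" := (map_poly intr p).[z] (at level 2).

(** Conjugation inverts z, and z^(2^(m+2)) = 1 turns the inverse into a power with natural exponent,
    so the conjugate is again an integer polynomial evaluated at z. *)
Lemma conj_ev (p : {poly int}) :
  (p%:ev)^* = (p \Po 'X^((2 ^ m.+2).-1))%:ev.
Proof.
have z_neq0 : z != 0.
  by apply: contra_eq_neq z_norm1 => ->; rewrite mul0r eq_sym oner_neq0.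
have zc : z^* = z ^+ (2 ^ m.+2).-1.
  apply: (mulfI z_neq0); rewrite z_norm1 -exprS prednK ?expn_gt0 //.
  by rewrite expnSr exprM zN sqrrN expr1n.
rewrite map_comp_poly horner_comp map_polyXn hornerXn -zc.
rewrite -horner_map -map_poly_comp; congr _.[_]; apply: eq_map_poly => x /=.
by rewrite rmorph_int.
Qed.

Lemma norm2_1DzM : (1 + z ^+ (2 ^ m)) * (1 + z ^+ (2 ^ m))^* = 2.
Proof.
have w2 : z ^+ (2 ^ m) * z ^+ (2 ^ m) = -1 by rewrite -expr2 -exprM -expnSr.
have wc : z ^+ (2 ^ m) * (z ^+ (2 ^ m))^* = 1.
  by rewrite rmorphXn -exprMn z_norm1 expr1n.
have w_neq0 : z ^+ (2 ^ m) != 0.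
  by apply: contra_eq_neq wc => ->; rewrite mul0r eq_sym oner_neq0.
have {}wc : (z ^+ (2 ^ m))^* = - z ^+ (2 ^ m).
  by apply: (mulfI w_neq0); rewrite wc mulrN w2 opprK.
by rewrite rmorphD rmorph1 /= wc; ring: w2.
Qed.

Lemma ev_step (p : {poly int}) (n : nat) :
  p%:ev * (p%:ev)^* = 2 ^+ n.+1 ->
  exists2 q : {poly int}, p%:ev = (1 + z ^+ (2 ^ m)) * q%:ev
    & q%:ev * (q%:ev)^* = 2 ^+ n.
Proof.
move=> pE; set M := (2 ^ m)%N.
have w2 : z ^+ M * z ^+ M = -1 by rewrite -expr2 -exprM -expnSr.
(* The norm equation at z becomes a polynomial identity modulo X^(2M) + 1. *)
have [r rE] : exists r,
    p * (p \Po 'X^((2 ^ m.+2).-1)) - 2 ^+ n.+1 = r * ('X^(2 ^ m.+1) + 1).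
  apply: (ev_eq0_dvd zN (p := p * _ - _)).
  rewrite rmorphB rmorphM rmorphXn /= rmorph_nat hornerD hornerN hornerM -conj_ev.
  by rewrite -polyC_natr -rmorphXn /= hornerC pE subrr.
pose f : {poly int} -> {poly 'F_2} := map_poly intr.
have F2N : -1 = 1 :> {poly 'F_2}.
  by apply/esym/eqP; rewrite -subr_eq0 opprK; apply/eqP/natr2_poly_F2.
have XD1 k : 'X^(2 ^ k) + 1 = ('X - 1) ^+ (2 ^ k) :> {poly 'F_2}.
  by rewrite F2N exprDn_pchar ?pnat2_poly_F2 // expr1n.
have /dvdpP[s sE] : ('X - 1) ^+ M %| f p.
  (* The exponent standing for conjugation is odd, hence nonzero in ['F_2]. *)
  apply: (@dvdp_XsubC1_comp_poly _ (2 ^ m.+2).-1).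
    have : (2 ^ m.+2).-1.+1%:R = 0 :> 'F_2.
      by rewrite prednK ?expn_gt0 // natrX pchar_Fp_0 // expr0n.
    rewrite -natr1; apply: contra_eq_neq => ->.
    by rewrite add0r oner_neq0.
  have -> : M.*2 = (2 ^ m.+1)%N by rewrite -mul2n -expnS.
  (* The constant 2^(n+1) vanishes modulo 2 because its exponent is positive. *)
  rewrite -XD1; apply/dvdpP; exists (f r).
  have := congr1 f rE; rewrite /f rmorphB rmorphM rmorphXn /= rmorph_nat.
  rewrite natr2_poly_F2 exprS mul0r subr0.
  by rewrite map_comp_poly map_polyXn rmorphM rmorphD /= map_polyXn rmorph1.
have [s' s'E] : exists s' : {poly int}, f s' = s.
  exists (map_poly (fun x : 'F_2 => (x : nat)%:Z) s).
  rewrite /f -map_poly_comp_id0 // map_poly_id // => x _ /=.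
  by rewrite -pmulrn natr_Zp.
have [t tE] : exists t : {poly int}, p = s' * ('X^M + 1) + t *+ 2.
  have [|t tE] := @poly_mod2_eq0 (p - s' * ('X^M + 1)).
    rewrite rmorphB rmorphM rmorphD /= map_polyXn rmorph1 XD1.
    by rewrite -/(f p) -/(f s') s'E sE subrr.
  by exists t; rewrite -tE addrC subrK.
(* With i = z^M, the first summand of [tE] has the factor 1 + i, and the second has it through 2 =
   (1 + i)(1 - i). *)
pose q := s' + t * (1 - 'X^M).
have evq : p%:ev = (1 + z ^+ M) * q%:ev.
  rewrite tE /q rmorphD rmorphMn rmorphM !rmorphD /= rmorphM rmorphB /=.
  rewrite map_polyXn rmorph1 !hornerE /=; ring: w2.
exists q => //; apply: (@mulfI _ 2); first by rewrite pnatr_eq0.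
by rewrite -exprS -pE evq rmorphM mulrACA norm2_1DzM.
Qed.

Lemma ev_steps (p : {poly int}) (n : nat) :
  p%:ev * (p%:ev)^* = 2 ^+ n ->
  exists2 q : {poly int}, p%:ev = (1 + z ^+ (2 ^ m)) ^+ n * q%:ev
    & q%:ev * (q%:ev)^* = 1.
Proof.
elim: n p => [|n IHn] p pE; first by exists p; rewrite ?mul1r // pE.
have [q -> /IHn[r -> rE]] := ev_step pE.
by exists r; rewrite // exprS mulrA.
Qed.

Lemma coef_sum_sqr_eq1 (p : {poly int}) :
    (size p <= 2 ^ m.+1)%N -> p%:ev * (p%:ev)^* = 1 ->
  \sum_(j < 2 ^ m.+1) p`_j ^+ 2 = 1.
Proof.
set N := (2 ^ m.+1)%N => szp pE.
have N_gt0 : (0 < N)%N by rewrite expn_gt0.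
(* T j l represents z^(j - l) by a monomial of degree < N; its constant
   coefficient is nonzero only for j = l. *)
pose T (j l : nat) : {poly int} :=
  if (l <= j)%N then 'X^(j - l) else - 'X^(N + j - l).
have szT (j l : 'I_N) : (size (T j l) <= N)%N.
  rewrite /T; case: (leqP l j) => le_lj; rewrite ?size_polyN size_polyXn.
    by rewrite (leq_ltn_trans _ (ltn_ord j)) // leq_subr.
  by have := ltn_ord l; lia.
have evT (j l : 'I_N) : (T j l)%:ev = z ^+ j * (z^*) ^+ l.
  have zz k : z ^+ k * z^* ^+ k = 1 by rewrite -exprMn z_norm1 expr1n.
  rewrite /T; case: leqP => le_lj.
    by rewrite map_polyXn hornerXn -{2}(subnK le_lj) exprD -mulrA zz mulr1.
  rewrite rmorphN /= map_polyXn hornerN hornerXn.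
  have le_l : (l <= N + j)%N by rewrite ltnW // ltn_addr.
  apply: (canLR opprK); rewrite -[LHS]mulr1 -(zz l) mulrA -exprD (subnK le_l).
  by rewrite exprD zN mulN1r mulNr.
(* [W] is the expansion of the squared modulus of p(z), reduced to degree < N; independence of the
   powers of z then forces [W = 1]. *)
pose W : {poly int} := \sum_(j < N) \sum_(l < N) (p`_j * p`_l) *: T j l.
have szW : (size (W - 1)%R <= N)%N.
  rewrite (leq_trans (size_polyD _ _)) // geq_max size_polyN size_poly1 N_gt0.
  rewrite andbT.
  apply: (leq_trans (size_sum _ _ _)); apply/bigmax_leqP => j _.
  apply: (leq_trans (size_sum _ _ _)); apply/bigmax_leqP => l _.
  exact: leq_trans (size_scale_leq _ _) (szT j l).
have evp : p%:ev = \sum_(j < N) (p`_j)%:~R * z ^+ j.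
  rewrite (@horner_coef_wide _ N) ?(leq_trans (size_poly _ _)) //.
  by apply: eq_bigr => j _; rewrite coef_map.
have W1 : W = 1.
  apply/eqP; rewrite -subr_eq0; apply/eqP/(root_unity_lin_indep zN szW).
  rewrite rmorphB rmorph1 hornerD hornerN hornerC; apply/eqP.
  rewrite subr_eq0 -pE; apply/eqP; rewrite /= evp rmorph_sum /=.
  rewrite mulr_suml rmorph_sum horner_sum.
  apply: eq_bigr => j _; rewrite mulr_sumr rmorph_sum horner_sum.
  apply: eq_bigr => l _; rewrite /= map_polyZ hornerZ evT.
  by rewrite !rmorphM rmorphXn /= rmorph_int mulrACA.
transitivity (W`_0); last by rewrite W1 coef1.
rewrite coef_sum; apply: eq_bigr => j _; rewrite coef_sum (bigD1 j) //= big1.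
  by rewrite addr0 coefZ /T leqnn subnn coefXn mulr1 expr2.
move=> l l_neq_j; rewrite coefZ /T; case: ltngtP => [lt_lj|lt_jl|/val_inj eq_lj].
- by rewrite coefXn eq_sym subn_eq0 leqNgt lt_lj mulr0.
- rewrite coefN coefXn eq_sym subn_eq0 leqNgt.
  by rewrite (leq_trans (ltn_ord l)) ?leq_addr // oppr0 mulr0.
- by rewrite eq_lj eqxx in l_neq_j.
Qed.

(** Integer squares with sum 1 are all 0 except for a single 1. *)
Lemma norm1_monomial (p : {poly int}) :
    (size p <= 2 ^ m.+1)%N -> p%:ev * (p%:ev)^* = 1 ->
  exists (s : bool) (j : nat), p%:ev = (-1) ^+ s * z ^+ j.
Proof.
move=> szp pE; have := coef_sum_sqr_eq1 szp pE.
set N := (2 ^ m.+1)%N => sum1.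
have [j pj] : exists j : 'I_N, p`_j != 0.
  apply/existsP; apply: contraT => /existsPn p0.
  move: sum1; rewrite big1 => [/eqP|j _]; first by rewrite eq_sym oner_eq0.
  by move: (p0 j); rewrite negbK => /eqP ->; rewrite expr0n.
rewrite (bigD1 j) //= in sum1.
have rest_ge0 : 0 <= \sum_(i < N | i != j) p`_i ^+ 2.
  by apply: sumr_ge0 => i _; rewrite sqr_ge0.
have pj1 : p`_j ^+ 2 = 1.
  have : 0 < p`_j ^+ 2 by rewrite exprn_even_gt0.
  by move: (p`_j ^+ 2) (\sum_(i < N | i != j) _) sum1 rest_ge0 => a b; lia.
have rest0 : \sum_(i < N | i != j) p`_i ^+ 2 = 0.
  by apply: (addrI (p`_j ^+ 2)); rewrite sum1 pj1 addr0.
have p0 (i : 'I_N) : i != j -> p`_i = 0.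
  move=> ij; apply/eqP; rewrite -sqrf_eq0.
  move/eqP: rest0; rewrite psumr_eq0 => [/allP/(_ i)|k _]; last exact: sqr_ge0.
  by rewrite mem_index_enum ij => /(_ isT).
exists (p`_j == -1), j.
rewrite (@horner_coef_wide _ N) ?(leq_trans (size_poly _ _)) //.
rewrite (bigD1 j) //= big1 => [|i ij]; last by rewrite coef_map /= p0 // mul0r.
rewrite addr0 coef_map /=; congr (_ * _).
by move/eqP: pj1; rewrite sqrf_eq1 => /orP[] /eqP ->; rewrite ?mulrN1z.
Qed.

Lemma ev_two_monomials (p : {poly int}) (h : nat) :
    (size p <= 2 ^ m.+1)%N -> p%:ev * (p%:ev)^* = 2 ^+ h.*2.+1 ->
  exists (s1 s2 : bool) (j1 j2 : 'I_(2 ^ m.+1)),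
    p = 2 ^+ h *: ((-1) ^+ s1 *: 'X^j1 + (-1) ^+ s2 *: 'X^j2).
Proof.
set N := (2 ^ m.+1)%N; have N_gt0 : (0 < N)%N by rewrite expn_gt0.
move=> szp /ev_steps[q pE qE].
have [r [q' [_ szq' evq']]] := ev_reduce zN q.
rewrite -evq' in pE qE; have [s [j q'E]] := norm1_monomial szq' qE.
(* Exponents are reduced modulo N; each full turn by N costs a sign, since z^N = -1. *)
have red k : exists (t : bool) (i : nat),
    (i < N)%N /\ z ^+ k = (-1) ^+ t * z ^+ i.
  exists (odd (k %/ N)), (k %% N)%N; rewrite ltn_pmod //; split => //.
  by rewrite {1}(divn_eq k N) exprD mulnC exprM zN signr_odd.
(* With i = z^(2^m), (1 + i)^(2h+1) = (2i)^h (1 + i) = 2^h (i^h + i^(h+1)); multiplying by z^j gives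
   these two exponents. *)
have [t1 [j1 [lt_j1 E1]]] := red (2 ^ m * h + j)%N.
have [t2 [j2 [lt_j2 E2]]] := red (2 ^ m * h.+1 + j)%N.
exists (s (+) t1), (s (+) t2), (Ordinal lt_j1), (Ordinal lt_j2).
apply/eqP; rewrite -subr_eq0; apply/eqP; apply: (root_unity_lin_indep zN).
  rewrite (leq_trans (size_polyD _ _)) // geq_max szp size_polyN.
  rewrite (leq_trans (size_scale_leq _ _)) // (leq_trans (size_polyD _ _)) //.
  by rewrite geq_max !(leq_trans (size_scale_leq _ _)) // size_polyXn.
have w2 : z ^+ (2 ^ m) ^+ 2 = -1 by rewrite -exprM -expnSr.
rewrite rmorphB /= map_polyZ rmorphD /= !map_polyZ /= !map_polyXn !hornerE /=.
rewrite !rmorphXn /= rmorphN1 !signr_addb -!mulrA -E1 -E2 pE q'E.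
rewrite exprS -mul2n exprM.
have -> : (1 + z ^+ (2 ^ m)) ^+ 2 = 2 * z ^+ (2 ^ m) by ring: w2.
rewrite exprMn !exprD mulnS !exprD !exprM; ring.
Qed.

End IntegerCombinations.

(** * Binary digits, signs, and the root of unity zeta *)

Lemma binary_digits (m : nat) (b : 'I_m -> nat) : (forall i, (b i < 2)%N) ->
  (\sum_(i < m) 2 ^ i * b i < 2 ^ m)%N /\
  forall i : 'I_m, odd ((\sum_(k < m) 2 ^ k * b k) %/ 2 ^ i) = b i :> nat.
Proof.
elim: m b => [|m IHm] b b_lt2; first by rewrite big_ord0; split => // -[].
have [lt_m digits] := IHm (fun i => b (lift ord0 i)) (fun i => b_lt2 _).
set s := (\sum_(i < m) _)%N in lt_m digits.
(* The lowest digit is split off, so that halving shifts the remaining digits down by one place. *)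
have -> : (\sum_(i < m.+1) 2 ^ i * b i = b ord0 + s * 2)%N.
  rewrite big_ord_recl mul1n /s big_distrl /=; congr addn.
  by apply: eq_bigr => i _; rewrite /bump /= add1n expnS -mulnA mulnC.
have b0 := b_lt2 ord0.
split=> [|i]; first by rewrite expnS; lia.
have [->|[j ->]] : i = ord0 \/ exists j, i = lift ord0 j.
  by case: (unliftP ord0 i) => [j ->|->]; [right; exists j | left].
  rewrite expn0 divn1 oddD oddM andbF addbF.
  by case: (b ord0) b0 => [|[|k]].
rewrite -(digits j) /= /bump /= add1n expnS divnMA divnDMl //.
by rewrite (divn_small b0).
Qed.

Lemma signF2D (a b : 'F_2) : (-1) ^+ (a + b)%R = (-1) ^+ a * (-1) ^+ b :> int.
Proof. by case: a => [[|[|a]] ?] //; case: b => [[|[|b]] ?]. Qed.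

Lemma signF2M (a b : 'F_2) : (-1) ^+ (a * b)%R = (-1) ^+ (a * b)%N :> int.
Proof. by case: a => [[|[|a]] ?] //; case: b => [[|[|b]] ?]. Qed.

Lemma signF2_sum (I : finType) (F : I -> 'F_2) :
  (-1) ^+ (\sum_i F i)%R = \prod_i (-1) ^+ F i :> int.
Proof. exact: (big_morph (fun a : 'F_2 => (-1) ^+ a : int) signF2D). Qed.

Section Zeta.
Local Open Scope complex_scope.

Lemma deMoivre (R : realType) (t : R) (n : nat) :
  (cos t +i* sin t) ^+ n = cos (t *+ n) +i* sin (t *+ n).
Proof.
elim: n => [|n IHn]; first by rewrite mulr0n cos0 sin0.
rewrite exprS IHn mulrS cosD sinD; simpc.
by congr (_ +i* _); rewrite addrC.
Qed.

Lemma zeta_half (R : realType) (m : nat) : zeta R m.+1 ^+ (2 ^ m) = -1.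
Proof.
rewrite /zeta deMoivre.
have -> : 2 * pi / 2 ^+ m.+1 *+ (2 ^ m) = pi :> R.
  rewrite -mulr_natr natrX exprS; field.
  by rewrite expf_neq0 // pnatr_eq0.
by rewrite cospi sinpi; apply/eqP; rewrite eq_complex /= oppr0 !eqxx.
Qed.

Lemma zeta_norm1 (R : realType) (k : nat) : zeta R k * (zeta R k)^*%R = 1.
Proof. by rewrite -normCK -add_Re2_Im2 /= cos2Dsin2. Qed.

End Zeta.

Lemma gbent_norm (R : realType) (k : nat) (V : vectType 'F_2)
    (ip : {symmetric V}) (f : V -> 'Z_(2 ^ k)) (u : V) :
  gbent R ip f ->
  gen_walsh R ip f u * (gen_walsh R ip f u)^* = 2 ^+ (\dim {:V}).
Proof.
move=> /(_ u) fu; rewrite -normCK fu -rmorphXn /= -powR_mulrn ?powR_ge0 //.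
rewrite -powRrM divfK ?pnatr_eq0 // powR_mulrn ?ler0n //.
by rewrite rmorphXn /= rmorph_nat.
Qed.

Lemma val_binary_value (m : nat) (V : vectType 'F_2) (a : 'I_m.+1 -> V -> 'F_2)
    (x : V) :
  binary_value a x = (\sum_(i < m.+1) 2 ^ i * a i x)%N :> nat.
Proof.
have [lt_m _] := @binary_digits m.+1 (fun i => a i x) (fun i => ltn_ord _).
have -> : binary_value a x = (\sum_(i < m.+1) 2 ^ i * a i x)%N%:R.
  by rewrite natr_sum; apply: eq_bigr => i _; rewrite natrM natrX.
by rewrite val_Zp_nat ?modn_small // -(expn0 2) ltn_exp2l.
Qed.

(** * Both transforms read off from one integer polynomial *)

Section Walsh.
Variables (m : nat) (V : vectType 'F_2) (ip : {symmetric V}).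
Variable (a : 'I_m.+1 -> V -> 'F_2).

Definition low_value (x : V) : nat :=
  (\sum_(i < m) 2 ^ i * a (widen_ord (leqnSn m) i) x)%N.

Lemma low_digits (x : V) : (low_value x < 2 ^ m)%N /\
  forall i : 'I_m,
    odd (low_value x %/ 2 ^ i) = a (widen_ord (leqnSn m) i) x :> nat.
Proof. exact: binary_digits (fun i => ltn_ord _). Qed.

Definition walsh_poly (u : V) : {poly int} :=
  \sum_(x : finvect_type V)
    ((-1) ^+ a ord_max x * (-1) ^+ ip u x) *: 'X^(low_value x).

Lemma size_walsh_poly (u : V) : (size (walsh_poly u) <= 2 ^ m)%N.
Proof.
apply: (leq_trans (size_sum _ _ _)); apply/bigmax_leqP => x _.
rewrite (leq_trans (size_scale_leq _ _)) // size_polyXn.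
by have [] := low_digits x.
Qed.

(** The top digit has weight 2^m and zeta^(2^m) = -1, so it contributes just the sign placed in the
    coefficient. *)
Lemma gen_walshE (R : realType) (f : V -> 'Z_(2 ^ m.+1)) (u : V) :
    (forall x, f x = binary_value a x) ->
  gen_walsh R ip f u = (map_poly intr (walsh_poly u)).[zeta R m.+1].
Proof.
move=> fE; rewrite /gen_walsh /walsh_poly rmorph_sum horner_sum.
apply: eq_bigr => x _; rewrite fE val_binary_value big_ord_recr /= -/(low_value x).
rewrite map_polyZ hornerZ map_polyXn hornerXn exprD exprM zeta_half.
by rewrite rmorphM !rmorphXn /= rmorphN1 [RHS]mulrC mulrA.
Qed.

Definition sign_char (c : 'rV['F_2]_m) (j : nat) : int :=
  \prod_(i < m) (-1) ^+ (c ord0 i * odd (j %/ 2 ^ i))%N.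

(** Each x contributes to the single index [low_value x], whose binary digits recover the values of
    all the a_i below the top one. *)
Lemma walshE (c : 'rV['F_2]_m) (u : V) :
  walsh ip (component a c) u
  = \sum_(j < 2 ^ m) (walsh_poly u)`_j * sign_char c j.
Proof.
under eq_bigr do rewrite coef_sum mulr_suml.
rewrite exchange_big; apply: eq_bigr => x _ /=.
have [lt_m digits] := low_digits x.
rewrite [RHS](bigD1 (Ordinal lt_m)) //=.
rewrite [X in _ = _ + X]big1 => [|j j_neq]; last first.
  rewrite coefZ coefXn; case: eqP => [jE|]; last by rewrite mulr0 mul0r.
  by case/eqP: j_neq; apply: val_inj.
rewrite addr0 coefZ coefXn eqxx mulr1 /component signF2D signF2_sum -mulrA mulrC.
congr (_ * _).
by apply: eq_bigr => i _; rewrite signF2M digits.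
Qed.

Lemma sign_char_sign (c : 'rV['F_2]_m) (j : nat) :
  exists s : bool, sign_char c j = (-1) ^+ s.
Proof.
apply: (big_ind (fun y : int => exists s : bool, y = (-1) ^+ s)).
- by exists false.
- by move=> _ _ [s ->] [t ->]; exists (s (+) t); rewrite signr_addb.
- by move=> i _; exists (odd (c ord0 i * odd (j %/ 2 ^ i))); rewrite signr_odd.
Qed.

End Walsh.

Theorem theorem4p3 (R : realType) (n m : nat) (V : vectType 'F_2)
    (ip : {symmetric V}) (f : V -> 'Z_(2 ^ m.+1))
    (a : 'I_m.+1 -> V -> 'F_2)
    (n_odd : odd n) (dimV : \dim {:V} = n) (ip_nondeg : nondegenerate ip)
    (f_gbent : gbent R ip f) (f_digits : forall x : V, f x = binary_value a x) :
  forall c : 'rV['F_2]_m, semibent ip (component a c).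
Proof.
move=> c u; rewrite dimV.
have [h nE] : exists h, n = h.*2.+1.
  by exists n./2; rewrite -[LHS]odd_double_half n_odd.
have := gbent_norm u f_gbent; rewrite dimV nE (gen_walshE ip R u f_digits).
have := zeta_norm1 R m.+1; have := zeta_half R m; rewrite (walshE ip a c u).
have := size_walsh_poly ip a u.
case: m f a f_gbent f_digits c => [|m] f a _ _ c szP zN z1.
  (* Case k = 1: the polynomial is constant, and its square 2^(2h+1) would have 2-adic valuation
     both even and odd. *)
  rewrite (size1_polyC szP) map_polyC hornerC /= rmorph_int -intrM -[2]/(2%:~R).
  rewrite -rmorphXn => /intr_inj /(congr1 absz); rewrite abszM abszX.
  set k := absz _ => kk.
  have k_gt0 : (0 < k)%N by case: k kk => // /esym/eqP; rewrite expn_eq0.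
  move/(congr1 (logn 2)): kk; rewrite lognM // pfactorK // => /(congr1 odd).
  by rewrite addnn /= !odd_double.
move=> /(ev_two_monomials zN z1 szP)[s1 [s2 [j1 [j2 ->]]]].
set P := 2 ^+ h *: _.
have -> : \sum_(j < 2 ^ m.+1) P`_j * sign_char c j =
    2 ^+ h * ((-1) ^+ s1 * sign_char c j1 + (-1) ^+ s2 * sign_char c j2).
  have one (s : bool) (j0 : 'I_(2 ^ m.+1)) :
      \sum_(j < 2 ^ m.+1) ((-1) ^+ s *: 'X^j0 : {poly int})`_j * sign_char c j
      = (-1) ^+ s * sign_char c j0.
    rewrite (bigD1 j0) //= coefZ coefXn eqxx mulr1 big1 ?addr0 // => j j_neq.
    by rewrite coefZ coefXn -[_ == _]/(j == j0) (negPf j_neq) mulr0 mul0r.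
  rewrite -!one -big_split mulr_sumr; apply: eq_bigr => j _.
  by rewrite coefZ coefD -mulrA mulrDl.
rewrite normrM normrX.
have [t1 ->] := sign_char_sign c j1; have [t2 ->] := sign_char_sign c j2.
have -> : (h.*2.+2)./2 = h.+1 by rewrite -doubleS doubleK.
rewrite exprSr -!signr_addb.
(* Equal signs add up to absolute value 2^(h+1), opposite signs cancel. *)
by case: (s1 (+) t1); case: (s2 (+) t2);
  by [right; congr (_ * _) | left; apply: mulr0].
Qed.
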